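(* Let $m\ge 1$. Consider an infinite eventually periodic continued fraction $x=[a_1,\ldots,a_n,\overline{b_1,\ldots,b_k}]$, and let $x_1,x_2,\ldots$ be its convergents ($x_N$ is the finite continued fraction given by the first $N$ terms). Then the limiting values $r_{i,m}(x)=\lim_{N\to\infty}r_{i,m}(x_N)$ belong to a degree $(m+1)$ field extension of $\mathbb{Q}$.
   Context: All continued fraction terms $a_i,b_j$ are positive integers, $k\ge 1$, and the bar denotes the infinitely repeated block $b_1,\ldots,b_k$. For a positive integer $a$ set $[\![a]\!]_k=\binom{a+k-1}{k}$ for $k\ge 0$ and $[\![a]\!]_k=0$ for $k<0$. $\Lambda^{(m)}(a)$ is the $(m+1)\times(m+1)$ matrix whose $(i,j)$-entry is $[\![a]\!]_{m+2-i-j}$, $1\le i,j\le m+1$. For positive integers $c_1,\ldots,c_N$ let $X=\Lambda^{(m)}(c_1)\cdots\Lambda^{(m)}(c_N)$ and $r_{i,m}(c_1,\ldots,c_N)=X_{m+1-i,1}/X_{m+1,1}$ for $0\le i\le m$. For a rational number $y=[c_1,\ldots,c_N]$ (finite continued fraction with positive integer terms) $r_{i,m}(y)$ means $r_{i,m}(c_1,\ldots,c_N)$; this does not depend on which of the two finite continued fraction expansions of $y$ is used. For every infinite sequence of positive integers $c_1,c_2,\ldots$ the limits $\lim_{N\to\infty} r_{i,m}(c_1,\ldots,c_N)$ exist.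
   Formalization: The limits are shown to lie in one common field of degree at most m+1, equal to m+1 if the characteristic polynomial of the period matrix is irreducible; exact degree m+1 fails in general (m=3, period 1: the limit r_{3,3} has degree 3). *)

(* Defs.v *)
From HB Require Import structures.
From mathcomp Require Import all_boot all_order all_algebra all_field.
From mathcomp Require Import all_classical all_reals all_analysis.
Import Order.TTheory GRing.Theory Num.Theory.
Import numFieldNormedType.Exports.

Set Implicit Arguments.
Unset Strict Implicit.
Unset Printing Implicit Defensive.

Local Open Scope ring_scope.

(* [[a]]_k = 'C(a + k - 1, k), extended by 0 to negative k; meant for a > 0 *)
Definition mbinom (a : nat) (k : int) : nat :=
  match k with
  | Posz k => 'C((a + k).-1, k)
  | Negz _ => 0%N
  end.

(* ordinals start at 0, hence the successors in the usual index m + 2 - i - j *)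
Definition Lambda (m a : nat) : 'M[rat]_m.+1 :=
  \matrix_(i, j) (mbinom a (m.+2%:Z - i.+1%:Z - j.+1%:Z))%:R.

Definition Lambda_prod (m : nat) (s : seq nat) : 'M[rat]_m.+1 :=
  \prod_(c <- s) Lambda m c.

(* r_{i,m}(s) = X_{m+1-i,1} / X_{m+1,1} with X = Lambda_prod m s; row m+1-i is
   rev_ord i when rows are counted from 0 *)
Definition r_cf (m : nat) (i : 'I_m.+1) (s : seq nat) : rat :=
  let X := Lambda_prod m s in X (rev_ord i) ord0 / X ord_max ord0.

(* j-th term, counted from 0, of [a_1, ..., a_n, overline(b_1, ..., b_k)] *)
Definition periodic_term (a b : seq nat) (j : nat) : nat :=
  if (j < size a)%N then nth 0%N a j
  else nth 0%N b ((j - size a) %% size b).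

(* r_{i,m}(x_N), where x_N is the continued fraction with the first N terms *)
Definition r_convergent (m : nat) (i : 'I_m.+1) (a b : seq nat) (N : nat) : rat :=
  r_cf i (mkseq (periodic_term a b) N).

Definition r_limit (R : realType) (m : nat) (i : 'I_m.+1) (a b : seq nat) : R :=
  limn (fun N : nat => ratr (r_convergent i a b N) : R).

(* Main.v *)
Require Import Defs.
From HB Require Import structures.
From mathcomp Require Import all_boot all_order all_algebra all_field.
From mathcomp Require Import all_classical all_reals all_analysis.
From mathcomp Require Import lra zify.
Import Order.TTheory GRing.Theory Num.Theory.
Import numFieldNormedType.Exports.

(** Write [A] and [B] for the products of the matrices [Lambda m c] over the
preperiod [a] and over the period [b].  After the preperiod, the vector whose
coordinate ratios are the [r_i] is [A *m B ^+ q *m w], where [w] is the first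
column of the product over a partial period.  The period matrix [B] has
nonnegative entries and [B ^+ 2] has positive ones, because [Lambda m c] is
positive on and above the antidiagonal and a product of two such matrices is
positive everywhere.  Perron-Frobenius theory ([perron_frobenius]) then gives a
positive eigenvector [u] of [B], for an eigenvalue [lam] with one-dimensional
eigenspace, such that the direction of [B ^+ q *m w] tends to that of [u]
uniformly in [w >= 0].  Hence [r_i] tends to the ratio of two coordinates of
[A *m u] ([r_limit_direction]).

The eigenvalue is a root of the characteristic polynomial of [B], which is
rational of degree [m + 1], so [K = Q(lam)] has degree at most [m + 1], with
equality if that polynomial is irreducible ([simple_extension_root]).  Over [K]
the matrix [B] has an eigenvector for [lam]; since the real eigenspace is a line,
its image in [R] is a multiple of [u], and the scalar cancels in the ratios.  So
the limits are images of ratios of elements of [K].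

The Perron-Frobenius step rests on a contraction of intervals.  If a functional
[f] lies between [lo * g] and [hi * g] for a positive functional [g], then so does
[f *m C] with respect to [g *m C] for any nonnegative [C]; and when [C] is
positive, one of the two bounds can be improved by a fixed proportion of
[hi - lo] ([interval_contraction]).  Taking a coordinate for [f] and the sum of
the coordinates for [g] and iterating shows that the normalized coordinates of
[C ^+ p *m w] converge, geometrically and uniformly in [w]. *)

Set Implicit Arguments.
Unset Strict Implicit.
Unset Printing Implicit Defensive.

Local Open Scope ring_scope.

(** * Eigenvectors and simple extensions *)

(** The column form of [eigenvalue_root_char], which speaks of row vectors: a
matrix and its transpose have the same characteristic polynomial. *)
Lemma char_poly_eigencol (F : fieldType) (n : nat) (A : 'M[F]_n) (a : F) :
  root (char_poly A) a <-> exists2 v : 'cV[F]_n, v != 0 & A *m v = a *: v.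
Proof.
have <- : char_poly A^T = char_poly A.
  rewrite /char_poly -[RHS]det_tr; congr (\det _).
  by apply/matrixP=> i j; rewrite !mxE eq_sym.
rewrite -eigenvalue_root_char; split=> [/eigenvalueP[v vA v0]|[v v0 Av]].
  exists v^T; first by rewrite -(inj_eq trmx_inj) trmxK trmx0.
  by apply: trmx_inj; rewrite trmx_mul trmxK vA linearZ /= trmxK.
apply/eigenvalueP; exists v^T; last by rewrite -(inj_eq trmx_inj) trmxK trmx0.
by rewrite -trmx_mul Av linearZ.
Qed.

(** The field is [F(z)], built from a polynomial of least size among the nonzero
ones that vanish at [z].  Minimality bounds the degree by that of [q], and an
irreducible [q] is itself of least size. *)
Lemma simple_extension_root (F L : fieldType) (iota : {rmorphism F -> L})
    (z : L) (q : {poly F}) :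
    q != 0 -> root (map_poly iota q) z ->
  exists (K : fieldExtType F) (j : {rmorphism K -> L}),
    [/\ exists x, j x = z, forall c : F, j c%:A = iota c,
        (\dim {:K} <= (size q).-1)%N
      & irreducible_poly q -> \dim {:K} = (size q).-1].
Proof.
move=> q0 qz.
pose P k := `[< exists p : {poly F}, [/\ p != 0, root (map_poly iota p) z & size p = k] >].
have exP : exists k, P k by exists (size q); apply/asboolP; exists q.
have [k /asboolP[p [p0 pz <-{k}]] minp] := ex_minnP exP.
have min_p r : root (map_poly iota r) z -> r != 0 -> (size p <= size r)%N.
  by move=> rz r0; apply: minp; apply/asboolP; exists r.
have irr_p : irreducible_poly p by apply/(subfx_irreducibleP pz p0).
pose K : fieldExtType F := SubFieldExtType pz irr_p.
have dimK : \dim {:K} = (size p).-1 by rewrite dimvf.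
pose j : {rmorphism K -> L} := @subfx_inj F L iota z p.
exists K, j; rewrite dimK; split.
- by exists (subfx_root iota z p); apply: subfx_inj_root.
- by move=> c; apply: subfx_inj_base.
- by rewrite -!subn1 leq_sub2r ?min_p.
- move=> /(subfx_irreducibleP qz q0) min_q; congr _.-1.
  by apply/eqP; rewrite eqn_leq min_p ?min_q.
Qed.

(** * Nonnegative and positive matrices *)

Definition nonneg_mx (R : numDomainType) (p q : nat) (M : 'M[R]_(p, q)) :=
  forall i j, 0 <= M i j.

Definition pos_mx (R : numDomainType) (p q : nat) (M : 'M[R]_(p, q)) :=
  forall i j, 0 < M i j.

(** The normalization of vectors; on nonnegative vectors it is the l^1 norm. *)
Definition mass (R : nmodType) (n : nat) (w : 'cV[R]_n) : R := \sum_i w i 0.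

Lemma pos_nonneg_mx (R : numDomainType) p q (M : 'M[R]_(p, q)) :
  pos_mx M -> nonneg_mx M.
Proof. by move=> M0 i j; apply: ltW. Qed.

Lemma nonneg_mulmx (R : numDomainType) p q r (M : 'M[R]_(p, q)) (N : 'M[R]_(q, r)) :
  nonneg_mx M -> nonneg_mx N -> nonneg_mx (M *m N).
Proof. by move=> M0 N0 i j; rewrite mxE sumr_ge0// => l _; rewrite mulr_ge0. Qed.

Lemma pos_sum_term (R : numDomainType) (I : finType) (f : I -> R) (l : I) :
  (forall i, 0 <= f i) -> 0 < f l -> 0 < \sum_i f i.
Proof.
move=> f0 fl; rewrite (bigD1 l)//= ltr_wpDr// sumr_ge0// => i _; exact: f0.
Qed.

Lemma nonneg_exp (R : numDomainType) n (M : 'M[R]_n.+1) k :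
  nonneg_mx M -> nonneg_mx (M ^+ k).
Proof.
move=> M0; elim: k => [|k IH]; first by move=> i j; rewrite expr0 mxE ler0n.
by rewrite exprS; apply: nonneg_mulmx.
Qed.

Lemma mass_ge0 (R : numDomainType) n (w : 'cV[R]_n) : nonneg_mx w -> 0 <= mass w.
Proof. by move=> w0; apply: sumr_ge0 => i _. Qed.

Lemma massZ (R : numDomainType) n (a : R) (w : 'cV[R]_n) :
  mass (a *: w) = a * mass w.
Proof. by rewrite /mass big_distrr; apply: eq_bigr => i _; rewrite mxE. Qed.

Lemma mass_gt0P (R : numDomainType) n (w : 'cV[R]_n) :
  nonneg_mx w -> 0 < mass w -> exists i, 0 < w i 0.
Proof.
move=> w0 tw; have [[i wi]//|Hno] := pselect (exists i, 0 < w i 0); first by exists i.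
suff : mass w = 0 by move=> E; rewrite E ltxx in tw.
apply: big1 => i _; apply/eqP; case: eqP => // /eqP wi.
by case: Hno; exists i; rewrite lt_def wi w0.
Qed.

Lemma mass_row (R : nzRingType) n (w : 'cV[R]_n) :
  ((const_mx 1 : 'rV_n) *m w) 0 0 = mass w.
Proof. by rewrite mxE; apply: eq_bigr => i _; rewrite mxE mul1r. Qed.

(** A quantitative and scale-invariant form of positivity, which [g *m C] inherits
from [C] with the same constant. *)
Definition balanced (R : numDomainType) (kap : R) p q (M : 'M[R]_(p, q)) :=
  forall i j i' j', kap * M i j <= M i' j'.

(** * Contraction by a positive matrix *)

Section Contraction.
Variables (R : realFieldType) (n : nat) (C : 'M[R]_n.+1) (kap : R).
Hypotheses (C0 : nonneg_mx C) (kap0 : 0 < kap) (balC : balanced kap C).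

Lemma balanced_mulmx (g : 'rV[R]_n.+1) : nonneg_mx g -> balanced kap (g *m C).
Proof.
move=> g0 i j i' j'; rewrite !mxE mulr_sumr ler_sum// => l _.
by rewrite mulrCA !ord1 ler_wpM2l// ?g0 ?balC.
Qed.

(** A gain [t] in coordinate 0 alone spreads to every coordinate of the image:
the term of index 0 makes up at least the fraction [kap ^+ 2 / n.+1] of each
coordinate of [g *m C], since [kap] bounds below both the ratios in [g] and those
in the columns of [C]. *)
Lemma contraction_gain (f g : 'rV[R]_n.+1) (t : R) :
    nonneg_mx f -> nonneg_mx g -> balanced kap g -> 0 <= t ->
    t * g 0 0 <= f 0 0 ->
  forall j, kap ^+ 2 / n.+1%:R * t * (g *m C) 0 j <= (f *m C) 0 j.
Proof.
move=> f0 g0 balg t0 tfg j.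
have step1 : kap ^+ 2 * (g *m C) 0 j <= n.+1%:R * (g 0 0 * C 0 j).
  have -> : n.+1%:R * (g 0 0 * C 0 j) = \sum_(l < n.+1) g 0 0 * C 0 j.
    by rewrite sumr_const card_ord mulr_natl.
  rewrite mxE mulr_sumr.
  apply: ler_sum => l _; rewrite expr2 mulrACA.
  by rewrite ler_pM// ?mulr_ge0 ?g0 ?C0 ?balg ?balC// ltW.
have step2 : t * (g 0 0 * C 0 j) <= (f *m C) 0 j.
  rewrite [leRHS]mxE (bigD1 0)//= mulrA.
  rewrite (le_trans (ler_wpM2r (C0 0 j) tfg))// lerDl sumr_ge0// => l _.
  by rewrite mulr_ge0 ?f0 ?C0.
apply: le_trans step2.
rewrite -mulrA [_ / _]mulrC -mulrA ler_pdivrMl ?ltr0n//.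
by rewrite [leLHS]mulrCA [leRHS]mulrCA ler_wpM2l.
Qed.


(** Compare [f 0 0] with the midpoint of the interval times [g 0 0].  If it is
larger, [f - lo *: g] has a gain of half the length in coordinate 0, which raises
the lower bound; otherwise the same argument for [hi *: g - f] lowers the upper
bound. *)
Lemma interval_contraction (f g : 'rV[R]_n.+1) (lo hi : R) :
    nonneg_mx g -> balanced kap g -> lo <= hi ->
    (forall j, lo * g 0 j <= f 0 j <= hi * g 0 j) ->
  exists lo' hi', hi' - lo' = (1 - kap ^+ 2 / n.+1%:R / 2) * (hi - lo) /\
    forall j, lo' * (g *m C) 0 j <= (f *m C) 0 j <= hi' * (g *m C) 0 j.
Proof.
move=> g0 balg lohi fg; set t := (hi - lo) / 2.
have t0 : 0 <= t by rewrite divr_ge0 ?subr_ge0.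
pose del := kap ^+ 2 / n.+1%:R * t.
have mono (h : 'rV[R]_n.+1) : nonneg_mx h -> nonneg_mx (h *m C).
  by move=> h0; apply: nonneg_mulmx.
have flo : nonneg_mx (f - lo *: g).
  by move=> i j; rewrite !mxE ord1 subr_ge0; case/andP: (fg j).
have fhi : nonneg_mx (hi *: g - f).
  by move=> i j; rewrite !mxE ord1 subr_ge0; case/andP: (fg j).
have lenE (x : R) : x = (hi - lo) - del ->
    x = (1 - kap ^+ 2 / n.+1%:R / 2) * (hi - lo).
  by move=> ->; rewrite /del /t [RHS]mulrBl mul1r; congr (_ - _); rewrite mulrA mulrAC.
have [mid|mid] := leP (lo * g 0 0 + t * g 0 0) (f 0 0).
  exists (lo + del), hi; split; first by apply: lenE; rewrite opprD addrA.
  move=> j; apply/andP; split; last first.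
    by have := mono _ fhi 0 j; rewrite mulmxBl -scalemxAl !mxE subr_ge0.
  have := @contraction_gain (f - lo *: g) g t flo g0 balg t0 _ j.
  rewrite !mulmxBl -scalemxAl !mxE => H; rewrite mulrDl addrC -lerBrDr; apply: H.
  by rewrite lerBrDr addrC.
exists lo, (hi - del); split; first by apply: lenE; rewrite addrAC.
move=> j; apply/andP; split.
  by have := mono _ flo 0 j; rewrite mulmxBl -scalemxAl !mxE subr_ge0.
have := @contraction_gain (hi *: g - f) g t fhi g0 balg t0 _ j.
rewrite !mulmxBl -scalemxAl !mxE => H; rewrite mulrBl lerBrDr -lerBrDl; apply: H.
rewrite lerBrDr -lerBrDl (le_trans (ltW mid))// -mulrDl -mulrBl.
by apply: ler_wpM2r => //; rewrite /t; lra.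
Qed.

Lemma iterated_contraction (f g : 'rV[R]_n.+1) (p : nat) :
    kap <= 1 -> nonneg_mx g -> balanced kap g ->
    (forall j, 0 <= f 0 j <= g 0 j) ->
  exists lo hi, hi - lo = (1 - kap ^+ 2 / n.+1%:R / 2) ^+ p /\
    forall w : 'cV[R]_n.+1, nonneg_mx w ->
      lo * (g *m (C ^+ p *m w)) 0 0 <= (f *m (C ^+ p *m w)) 0 0
        <= hi * (g *m (C ^+ p *m w)) 0 0.
Proof.
move=> kap1 g0 balg fg.
set rho := 1 - _.
have rho0 : 0 <= rho.
  have k0 := ltW kap0.
  rewrite subr_ge0 -mulrA -invfM mulr_ile1 ?exprn_ge0 ?exprn_ile1 ?invr_ge0//.
  by rewrite invf_le1 ?mulr_gt0// -natrM ler1n.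
have inv : exists lo hi, [/\ hi - lo = rho ^+ p, nonneg_mx (g *m C ^+ p),
    balanced kap (g *m C ^+ p)
  & forall j, lo * (g *m C ^+ p) 0 j <= (f *m C ^+ p) 0 j <= hi * (g *m C ^+ p) 0 j].
  elim: p => [|p [lo [hi [len gp0 balp fgp]]]].
    exists 0, 1; rewrite !expr0 !mulmx1 subr0; split=> // j.
    by rewrite mul0r mul1r.
  have lohi : lo <= hi by rewrite -subr_ge0 len exprn_ge0.
  have [lo' [hi' [len' fg']]] := interval_contraction gp0 balp lohi fgp.
  have CS : C ^+ p.+1 = C ^+ p *m C := exprSr C p.
  exists lo', hi'; rewrite CS !mulmxA len' len -exprS; split=> //.
    exact: nonneg_mulmx.
  exact: balanced_mulmx.
have [lo [hi [len gp0 balp fgp]]] := inv.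
exists lo, hi; split=> // w w0; rewrite !mulmxA.
move: (g *m _) (f *m _) fgp => G F FG; rewrite !mxE !mulr_sumr.
by rewrite !ler_sum// => j _; rewrite mulrA ler_wpM2r//; case/andP: (FG j).
Qed.

End Contraction.


(** The inverse of [kap] is the sum of all ratios of two entries, so it bounds each
of them. *)
Lemma pos_balanced (R : realFieldType) n (C : 'M[R]_n.+1) :
  pos_mx C -> exists kap, [/\ 0 < kap, kap <= 1 & balanced kap C].
Proof.
move=> C0; pose I := ('I_n.+1 * 'I_n.+1)%type.
pose r (x : I * I) : R := C x.1.1 x.1.2 / C x.2.1 x.2.2.
have r0 x : 0 < r x by rewrite divr_gt0.
have rle x : r x <= \sum_y r y.
  by rewrite (bigD1 x)//= lerDl sumr_ge0// => y _; apply: ltW.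
have s0 : 0 < \sum_y r y.
  apply: (@pos_sum_term _ _ _ (((0, 0), (0, 0)) : I * I)) => // x; exact: ltW.
exists (\sum_y r y)^-1; rewrite invr_gt0; split=> //.
  rewrite invf_le1//; apply: le_trans (rle ((0, 0), (0, 0))).
  by rewrite /r divff// gt_eqF.
move=> i j i' j'; rewrite ler_pdivrMl// -ler_pdivrMr//.
exact: (rle ((i, j), (i', j'))).
Qed.

Lemma pos_mulmx (R : numDomainType) p q r (M : 'M[R]_(p, q.+1)) (N : 'M[R]_(q.+1, r)) :
  pos_mx M -> pos_mx N -> pos_mx (M *m N).
Proof.
move=> M0 N0 i j; rewrite mxE (@pos_sum_term _ _ _ ord0)// => [l|].
  by rewrite mulr_ge0 ?ltW.
by rewrite mulr_gt0.
Qed.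

Lemma pos_iter_mulmx (R : numDomainType) n (C : 'M[R]_n.+1) (w : 'cV[R]_n.+1) p :
  pos_mx C -> pos_mx w -> pos_mx (C ^+ p *m w).
Proof.
move=> C0 w0; elim: p => [|p IH]; first by rewrite expr0 mul1mx.
by rewrite exprS -mulmxE -mulmxA; apply: pos_mulmx.
Qed.

Lemma mass_pos (R : numDomainType) n (w : 'cV[R]_n.+1) : pos_mx w -> 0 < mass w.
Proof. by move=> w0; rewrite (@pos_sum_term _ _ _ ord0)// => i; apply: ltW. Qed.

(** * Perron-Frobenius theorem for primitive matrices *)

(** For each coordinate [i] the lower bounds valid at some stage [p] stay valid
afterwards, and every upper bound dominates them, so their supremum lies in all
the intervals of [iterated_contraction], whose lengths tend to 0. *)
Lemma pos_powers_limit (R : realType) n (C : 'M[R]_n.+1) :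
    pos_mx C ->
  exists u : 'cV[R]_n.+1, forall e, 0 < e -> exists p,
    forall w : 'cV[R]_n.+1, nonneg_mx w -> forall i,
      `|(C ^+ p *m w) i 0 - u i 0 * mass (C ^+ p *m w)| <= e * mass (C ^+ p *m w).
Proof.
move=> C0; have [kap [kap0 kap1 balC]] := pos_balanced C0.
have C0' := pos_nonneg_mx C0.
set rho := 1 - kap ^+ 2 / n.+1%:R / 2.
have bracket i p : exists lo hi, hi - lo = rho ^+ p /\
    forall w : 'cV[R]_n.+1, nonneg_mx w ->
    lo * mass (C ^+ p *m w) <= (C ^+ p *m w) i 0 <= hi * mass (C ^+ p *m w).
  have [||j|lo [hi [len H]]] := @iterated_contraction _ _ _ _ C0' kap0 balC
    (delta_mx 0 i) (const_mx 1) p kap1.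
  - by move=> k l; rewrite mxE.
  - by move=> k l k' l'; rewrite !mxE mulr1.
  - by rewrite !mxE ler0n lern1 leq_b1.
  exists lo, hi; split=> // w w0.
  by have := H w w0; rewrite !mass_row -!rowE !mxE.
pose T (i : 'I_n.+1) : set R := [set x : R | exists p, forall w : 'cV[R]_n.+1, nonneg_mx w ->
  x * mass (C ^+ p *m w) <= (C ^+ p *m w) i 0]%classic.
(* Two bounds found at different stages are compared on a vector obtained from
   [ones] by both numbers of steps. *)
pose ones : 'cV[R]_n.+1 := const_mx 1.
have ones0 : pos_mx ones by move=> i j; rewrite mxE.
have ubT i p hi : (forall w : 'cV[R]_n.+1, nonneg_mx w ->
    (C ^+ p *m w) i 0 <= hi * mass (C ^+ p *m w)) -> ubound (T i) hi.
  move=> Hhi x [p' Hx].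
  have E : C ^+ p *m (C ^+ p' *m ones) = C ^+ p' *m (C ^+ p *m ones).
    by rewrite !mulmxA !mulmxE -!exprD addnC.
  have pos k : nonneg_mx (C ^+ k *m ones).
    by apply: pos_nonneg_mx; apply: pos_iter_mulmx.
  have tot0 : 0 < mass (C ^+ p' *m (C ^+ p *m ones)).
    by apply: mass_pos; do 2!apply: pos_iter_mulmx => //.
  rewrite -(ler_pM2r tot0) (le_trans (Hx _ (pos p)))// -E.
  exact: Hhi.
exists (\col_i sup (T i)) => e e0.
have rho01 : `|rho| < 1.
  have k2 : 0 < kap ^+ 2 / n.+1%:R / 2 by rewrite !divr_gt0 ?exprn_gt0.
  have k2' : kap ^+ 2 / n.+1%:R / 2 <= 1.
    rewrite -mulrA -invfM mulr_ile1 ?exprn_ge0 ?exprn_ile1 ?invr_ge0 ?(ltW kap0)//.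
    by rewrite invf_le1 ?mulr_gt0// -natrM ler1n.
  move: k2 k2'; rewrite /rho; move: (_ / 2) => k k2 k2'.
  by rewrite ltr_norml; apply/andP; split; lra.
have [p rhop] : exists p, rho ^+ p <= e.
  have /cvgrPdist_le/(_ e e0)[p _ Hp] := cvg_expr rho01.
  exists p; have := Hp p (leqnn p); rewrite sub0r normrN; exact/le_trans/ler_norm.
exists p => w w0 i; rewrite [(\col__ _) i 0]mxE.
have [lo [hi [len H]]] := bracket i p.
have tot0 : 0 <= mass (C ^+ p *m w).
  by apply/mass_ge0/nonneg_mulmx => //; apply: nonneg_exp.
have Tlo : T i lo by exists p => w' /H/andP[].
have ubhi : ubound (T i) hi by apply: (@ubT i p) => w' /H/andP[].
have supge : lo <= sup (T i) by apply: ub_le_sup => //; exists hi.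
have suple : sup (T i) <= hi by apply: ge_sup => //; exists lo.
have /andP[H1 H2] := H w w0.
have G1 := ler_wpM2r tot0 supge; have G2 := ler_wpM2r tot0 suple.
have G3 := ler_wpM2r tot0 rhop; rewrite -len mulrBl in G3.
rewrite ler_norml.
move: H1 H2 G1 G2 G3; move: (mass _) ((_ *m _) i 0) => tot y.
move: (lo * tot) (hi * tot) (sup _ * tot) (e * tot) => x1 x2 x3 x4.
by move=> *; apply/andP; split; lra.
Qed.

(** The deviation is measured relative to the mass, so that the condition is
homogeneous in [y] and needs no division. *)
Definition near_direction (R : numDomainType) n (u : 'cV[R]_n) (e : R) (y : 'cV[R]_n) :=
  forall i, `|y i 0 - u i 0 * mass y| <= e * mass y.

(** The rank [q0] does not depend on [w]: the vectors to which the powers of [B]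
are applied vary with the length of the truncated continued fraction. *)
Definition attracts (R : numDomainType) n (B : 'M[R]_n.+1) (u : 'cV[R]_n.+1) :=
  forall e, 0 < e -> exists q0, forall q, (q0 <= q)%N ->
    forall w : 'cV[R]_n.+1, nonneg_mx w -> near_direction u e (B ^+ q *m w).

Lemma primitive_attracts (R : realType) n (B : 'M[R]_n.+1) (N : nat) :
  nonneg_mx B -> pos_mx (B ^+ N) -> exists u, attracts B u.
Proof.
move=> B0 /pos_powers_limit[u Hu]; exists u => e e0.
have [p Hp] := Hu e e0; exists (N * p)%N => q leq w w0.
rewrite -(subnKC leq) exprD -mulmxE -mulmxA exprM => i.
by apply: Hp; apply: nonneg_mulmx => //; apply: nonneg_exp.
Qed.

Lemma normalized_cvg (R : realType) n (u : 'cV[R]_n) (y : nat -> 'cV[R]_n) (l : 'I_n) :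
    (forall M, 0 < mass (y M)) ->
    (forall e, 0 < e -> exists M0, forall M, (M0 <= M)%N -> near_direction u e (y M)) ->
  ((fun M => y M l 0 / mass (y M)) @ \oo --> u l 0)%classic.
Proof.
move=> tot0 near_u; apply/cvgrPdistC_le => e e0; have [M0 HM] := near_u e e0.
exists M0 => // M /= leM; rewrite -[u l 0](mulfK (lt0r_neq0 (tot0 M))) -mulrBl.
rewrite normrM normfV (gtr0_norm (tot0 M)) ler_pdivrMr//; exact: HM.
Qed.

Lemma normalized_mulmx_cvg (R : realType) n p (A : 'M[R]_(p, n)) (u : 'cV[R]_n)
    (y : nat -> 'cV[R]_n) (i : 'I_p) :
    (forall M, 0 < mass (y M)) ->
    (forall e, 0 < e -> exists M0, forall M, (M0 <= M)%N -> near_direction u e (y M)) ->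
  ((fun M => (A *m y M) i 0 / mass (y M)) @ \oo --> (A *m u) i 0)%classic.
Proof.
move=> tot0 near_u.
rewrite mxE; under eq_cvg do rewrite mxE mulr_suml.
apply: cvg_big => [|l _]; first exact: add_continuous.
 under eq_cvg do rewrite -mulrA.
by apply: cvgMl_tmp; apply: normalized_cvg.
Qed.

(** No row of [B] vanishes, as otherwise the same row of [B ^+ N.+1] would. *)
Lemma primitive_pos_mulmx (R : realDomainType) n (B : 'M[R]_n.+1) (N : nat) (w : 'cV[R]_n.+1) :
  nonneg_mx B -> pos_mx (B ^+ N.+1) -> pos_mx w -> pos_mx (B *m w).
Proof.
move=> B0 BN w0 i j.
have [l Bil] : exists l, 0 < B i l.
  have [//|Hno] := pselect (exists l, 0 < B i l).
  have := BN i 0; rewrite exprS -mulmxE mxE big1 ?ltxx// => l _.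
  have [Bl|Bl] := ltP 0 (B i l); first by case: Hno; exists l.
  suff -> : B i l = 0 by rewrite mul0r.
  by apply/eqP; rewrite eq_le Bl B0.
rewrite mxE (@pos_sum_term _ _ _ l)// ?mulr_gt0// => k.
by apply: mulr_ge0 => //; apply: ltW.
Qed.

(** The normalized iterates [y q] converge to [u]; applying [B] once more shows
that [u] is an eigenvector, and positivity of [B ^+ N.+1] makes [u] positive.
For simplicity, let [v] be another eigenvector for [lam]: for a large [c] the
eigenvector [w = v + c *: u] is nonnegative, hence attracted by [u]; but its
direction is constant along the iteration, so [w] is already a multiple of [u]. *)
Theorem perron_frobenius (R : realType) n (B : 'M[R]_n.+1) (N : nat) :
    nonneg_mx B -> pos_mx (B ^+ N.+1) ->
  exists (u : 'cV[R]_n.+1) (lam : R),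
    [/\ pos_mx u, B *m u = lam *: u, attracts B u
      & forall v, B *m v = lam *: v -> exists c, v = c *: u].
Proof.
move=> B0 BN; have [u attr] := primitive_attracts B0 BN.
pose y q : 'cV[R]_n.+1 := B ^+ q *m const_mx 1.
have y0 q : pos_mx (y q).
  elim: q => [|q IH]; first by move=> i j; rewrite /y expr0 mul1mx mxE.
  by rewrite /y exprS -mulmxE -mulmxA; apply: primitive_pos_mulmx BN _.
have tot0 q : 0 < mass (y q) by apply: mass_pos.
have near_y e : 0 < e -> exists q0, forall q, (q0 <= q)%N -> near_direction u e (y q).
  move=> e0; have [q0 Hq] := attr e e0; exists q0 => q leq.
  by apply: Hq => // i j; rewrite mxE.
have ycvg p (A : 'M[R]_(p, n.+1)) i := normalized_mulmx_cvg (A := A) (i := i) tot0 near_y.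
have totu : mass u = 1.
  have := ycvg 1 (const_mx 1) 0.
  under eq_cvg do rewrite mass_row divff ?gt_eqF//.
  rewrite mass_row => /(cvg_unique (@Rhausdorff R)); apply; exact: cvg_cst.
have u0 : nonneg_mx u.
  move=> i j; rewrite ord1 leNgt; apply/negP => ui.
  have e0 : 0 < - u i 0 / 2 by rewrite divr_gt0 ?oppr_gt0.
  have [q0 Hq] := near_y _ e0.
  have := Hq q0 (leqnn q0) i; rewrite ler_norml => /andP[_].
  have := mulr_gt0 (tot0 q0) e0; have := y0 q0 i 0.
  by move: (mass _) (y _ _ _) (u i 0) => t a b; nra.
pose lam := mass (B *m u).
have yS q : y q.+1 = B *m y q by rewrite /y exprS -mulmxE mulmxA.
have Bu : B *m u = lam *: u.
  apply/matrixP=> i j; rewrite ord1 [RHS]mxE.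
  apply: (cvg_unique (@Rhausdorff R) (ycvg _ B i)).
  have c1 : ((fun q => mass (y q.+1) / mass (y q)) @ \oo --> lam)%classic.
    rewrite /lam -mass_row mulmxA; under eq_cvg do rewrite yS -mass_row mulmxA.
    exact: ycvg.
  have c2 : ((fun q => y q.+1 i 0 / mass (y q.+1)) @ \oo --> u i 0)%classic.
    rewrite (cvg_shiftS (fun q => y q i 0 / mass (y q))).
    exact: normalized_cvg.
  have -> : (fun q => (B *m y q) i 0 / mass (y q)) =
      (fun q => mass (y q.+1) / mass (y q)) \* (fun q => y q.+1 i 0 / mass (y q.+1)).
    by apply/funext => q; rewrite /= [RHS]mulrC mulrA divfK ?gt_eqF// yS.
  exact: cvgM c1 c2.
have powE v l q : B *m v = l *: v -> B ^+ q *m v = l ^+ q *: v.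
  move=> Bv; elim: q => [|q IH]; first by rewrite !expr0 mul1mx scale1r.
  by rewrite exprSr -mulmxE -mulmxA Bv -scalemxAr IH scalerA -exprS.
have [k uk] : exists k, 0 < u k 0 by apply: mass_gt0P; rewrite ?totu.
have lamge : 0 <= lam by apply/mass_ge0/nonneg_mulmx.
have lamu i : 0 < lam ^+ N.+1 * u i 0.
  have -> : lam ^+ N.+1 * u i 0 = (B ^+ N.+1 *m u) i 0.
    by rewrite (powE _ _ _ _ Bu) mxE.
  rewrite mxE (@pos_sum_term _ _ _ k) ?mulr_gt0 ?BN// => l.
  by rewrite mulr_ge0 ?u0// ltW ?BN.
have upos : pos_mx u.
  move=> i j; rewrite ord1 lt_def u0 andbT; apply/eqP => ui.
  by have := lamu i; rewrite ui mulr0 ltxx.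
have lampos : 0 < lam.
  rewrite lt_def lamge andbT; apply/eqP => l0.
  by have := lamu 0; rewrite l0 exprS !mul0r ltxx.
exists u, lam; split=> // v Bv.
(* This [c] is at least [`|v i 0| / u i 0] for every [i]. *)
pose c := \sum_i `|v i 0| / u i 0; pose w := v + c *: u.
have w0 : nonneg_mx w.
  move=> i j; rewrite ord1 !mxE -lerBlDl sub0r.
  apply: (le_trans (ler_norm _)); rewrite normrN -ler_pdivrMr//.
  rewrite /c (bigD1 i)//= lerDl sumr_ge0// => l _.
  by rewrite divr_ge0// u0.
have Bw : B *m w = lam *: w.
  by rewrite mulmxDr Bv -scalemxAr Bu scalerDr !scalerA mulrC.
have wu : w = mass w *: u.
  apply/matrixP=> i j; rewrite ord1 [RHS]mxE; apply/eqP.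
  rewrite -subr_eq0 -normr_le0; apply/ler_addgt0Pr => e e0; rewrite add0r.
  have tw := mass_ge0 w0; have tw1 : 0 < 1 + mass w by rewrite ltr_wpDr.
  have [q Hq] := attr (e / (1 + mass w)) (divr_gt0 e0 tw1).
  have := Hq q (leqnn q) w w0 i.
  rewrite (powE _ _ _ _ Bw) massZ [_ i 0]mxE mulrCA -mulrBr normrM.
  rewrite ger0_norm ?exprn_ge0// mulrCA ler_pM2l ?exprn_gt0// mulrC => H.
  apply: le_trans H _; rewrite -mulrA ger_pMr// mulrC ler_pdivrMr// mul1r lerDr.
  exact: ler01.
exists (mass w - c); rewrite scalerBl -wu /w addrK //.
Qed.

(** * Products of the matrices Lambda *)

Definition Lambda_prod_in (R : unitRingType) (m : nat) (s : seq nat) : 'M[R]_m.+1 :=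
  map_mx ratr (Lambda_prod m s).

Lemma Lambda_gt0 (m c : nat) (i j : 'I_m.+1) :
  (0 < c)%N -> (i + j <= m)%N -> 0 < Lambda m c i j.
Proof.
move=> c0 ij; rewrite mxE ltr0n.
have -> : m.+2%:Z - i.+1%:Z - j.+1%:Z = Posz (m - i - j) by lia.
by rewrite bin_gt0; lia.
Qed.

Lemma Lambda_ge0 (m c : nat) : nonneg_mx (Lambda m c).
Proof. by move=> i j; rewrite mxE ler0n. Qed.

Section LambdaProduct.
Variables (R : realFieldType) (m : nat).
Implicit Type s : seq nat.

Local Notation LR := (Lambda_prod_in R m).
Local Notation Lam c := (map_mx ratr (Lambda m c) : 'M[R]_m.+1).

Lemma Lambda_prod_in_nil : LR [::] = 1%:M.
Proof. by rewrite /Lambda_prod_in /Lambda_prod big_nil map_mx1. Qed.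

Lemma Lambda_prod_in_cons c s : LR (c :: s) = Lam c *m LR s.
Proof. by rewrite /Lambda_prod_in /Lambda_prod big_cons -map_mxM. Qed.

Lemma Lambda_prod_in_cat s t : LR (s ++ t) = LR s *m LR t.
Proof. by rewrite /Lambda_prod_in /Lambda_prod big_cat -map_mxM. Qed.

Lemma nonneg_Lambda_in c : nonneg_mx (Lam c).
Proof. by move=> i j; rewrite mxE ler0q Lambda_ge0. Qed.

Lemma nonneg_Lambda_prod s : nonneg_mx (LR s).
Proof.
elim: s => [|c s IH]; first by move=> i j; rewrite Lambda_prod_in_nil mxE ler0n.
by rewrite Lambda_prod_in_cons; apply: nonneg_mulmx => //; apply: nonneg_Lambda_in.
Qed.

(** Column 0 of [Lambda m c] is positive in all rows. *)
Lemma pos_Lambda_mulmx c q (M : 'M[R]_(m.+1, q)) :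
  (0 < c)%N -> pos_mx M -> pos_mx (Lam c *m M).
Proof.
move=> c0 M0 i j; rewrite mxE (@pos_sum_term _ _ _ 0)// => [l|].
  by apply: mulr_ge0; [exact: nonneg_Lambda_in | exact: ltW].
by rewrite mulr_gt0// mxE ltr0q Lambda_gt0// addn0 -ltnS.
Qed.

Lemma pos_Lambda_prod_mulmx s q (M : 'M[R]_(m.+1, q)) :
  (forall c, c \in s -> (0 < c)%N) -> pos_mx M -> pos_mx (LR s *m M).
Proof.
elim: s => [|c s IH] s0 M0; first by rewrite Lambda_prod_in_nil mul1mx.
rewrite Lambda_prod_in_cons -mulmxA; apply: pos_Lambda_mulmx.
  by apply: s0; rewrite mem_head.
by apply: IH => // d ds; apply: s0; rewrite inE ds orbT.
Qed.

(** The last two factors have a positive product because the first has a positive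
column 0 and the second a positive row 0; the factors before them preserve
positivity. *)
Lemma pos_Lambda_prod s :
  (forall c, c \in s -> (0 < c)%N) -> (1 < size s)%N -> pos_mx (LR s).
Proof.
case/lastP: s => // s d; case/lastP: s => // s c s0 _.
rewrite -!cats1 -catA Lambda_prod_in_cat; apply: pos_Lambda_prod_mulmx => [x xs|].
  by apply: s0; rewrite !(mem_rcons, inE) xs !orbT.
have c0 : (0 < c)%N by apply: s0; rewrite !(mem_rcons, inE) eqxx orbT.
have d0 : (0 < d)%N by apply: s0; rewrite mem_rcons mem_head.
rewrite /= !Lambda_prod_in_cons Lambda_prod_in_nil mulmx1 => i j.
rewrite mxE (@pos_sum_term _ _ _ 0)// => [l|].
  by apply: mulr_ge0; exact: nonneg_Lambda_in.
by apply: mulr_gt0; rewrite mxE ltr0q Lambda_gt0// ?addn0; apply: leq_ord.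
Qed.

(** The entry (0, 0) is positive for every product, even for the empty one. *)
Lemma mass_Lambda_prod s :
  (forall c, c \in s -> (0 < c)%N) -> 0 < mass (col 0 (LR s)).
Proof.
move=> s0; apply: (@pos_sum_term _ _ _ 0) => [i|].
  by rewrite mxE; apply: nonneg_Lambda_prod.
elim: s s0 => [|c s IH] s0; first by rewrite Lambda_prod_in_nil !mxE ltr01.
rewrite Lambda_prod_in_cons !mxE (@pos_sum_term _ _ _ 0)// => [l|].
  by apply: mulr_ge0; [exact: nonneg_Lambda_in | exact: nonneg_Lambda_prod].
apply: mulr_gt0; first by rewrite mxE ltr0q Lambda_gt0// s0 ?mem_head.
have -> : LR s 0 0 = col 0 (LR s) 0 0 by rewrite [RHS]mxE.
by rewrite IH// => d ds; apply: s0; rewrite inE ds orbT.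
Qed.

End LambdaProduct.

(** * Limits of the ratios along a periodic continued fraction *)

Definition cyclic_prefix (b : seq nat) (M : nat) : seq nat :=
  mkseq (fun j => nth 0%N b (j %% size b)) M.

Lemma periodic_prefix (a b : seq nat) (M : nat) :
  mkseq (periodic_term a b) (size a + M) = a ++ cyclic_prefix b M.
Proof.
rewrite /mkseq iotaD map_cat add0n; congr (_ ++ _).
  rewrite -[RHS]take_size -(map_nth_iota0 0%N (leqnn _)).
  by apply/eq_in_map => j; rewrite mem_iota /periodic_term => /= ->.
rewrite /cyclic_prefix /mkseq -[size a in LHS]addn0 iotaDl -map_comp.
by apply: eq_map => j /=; rewrite /periodic_term ltnNge leq_addr /= addKn.
Qed.

Lemma cyclic_prefixD (b : seq nat) (M : nat) :
  cyclic_prefix b (size b + M) = b ++ cyclic_prefix b M.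
Proof.
rewrite -periodic_prefix; apply: eq_map => j; rewrite /periodic_term.
case: ltnP => [jb|bj]; first by rewrite modn_small.
by rewrite -{1}(subnK bj) modnDr.
Qed.

Lemma Lambda_prod_cyclic_prefix (R : realFieldType) m b q M :
  Lambda_prod_in R m (cyclic_prefix b (q * size b + M)) =
  Lambda_prod_in R m b ^+ q *m Lambda_prod_in R m (cyclic_prefix b M).
Proof.
elim: q => [|q IH]; first by rewrite mul0n add0n expr0 mul1mx.
rewrite mulSn -addnA cyclic_prefixD Lambda_prod_in_cat IH mulmxA.
by rewrite mulmxE -exprS.
Qed.

Lemma r_convergent_in (R : realFieldType) m (i : 'I_m.+1) a b M :
  let X := Lambda_prod_in R m a *m col 0 (Lambda_prod_in R m (cyclic_prefix b M)) in
  ratr (r_convergent i a b (size a + M)) = X (rev_ord i) 0 / X ord_max 0 :> R.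
Proof.
rewrite /= colE mulmxA -colE -Lambda_prod_in_cat -periodic_prefix.
by rewrite /r_convergent /r_cf fmorph_div !mxE.
Qed.

(** Among the first [M] periodic terms there are [M %/ size b] full periods, so the
first columns are powers of the period matrix applied to nonnegative vectors, and
[u] attracts them; both coordinates of the ratio converge once divided by the
mass of the column. *)
Lemma r_limit_direction (R : realType) m (a b : seq nat) (u : 'cV[R]_m.+1) (i : 'I_m.+1) :
    (0 < size b)%N ->
    (forall c, c \in a -> (0 < c)%N) -> (forall c, c \in b -> (0 < c)%N) ->
    pos_mx u -> attracts (Lambda_prod_in R m b) u ->
  r_limit R i a b = (Lambda_prod_in R m a *m u) (rev_ord i) 0
                    / (Lambda_prod_in R m a *m u) ord_max 0.
Proof.
move=> b_gt0 a0 b0 u0 attr; set A := Lambda_prod_in R m a.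
pose y M : 'cV[R]_m.+1 := col 0 (Lambda_prod_in R m (cyclic_prefix b M)).
have pfx0 M c : c \in cyclic_prefix b M -> (0 < c)%N.
  by move=> /mapP[j _ ->]; rewrite b0// mem_nth// ltn_mod.
have mass0 M : 0 < mass (y M) by apply: mass_Lambda_prod => c; apply: pfx0.
have near_y e : 0 < e -> exists M0, forall M, (M0 <= M)%N -> near_direction u e (y M).
  move=> e0; have [q0 Hq] := attr e e0; exists (q0 * size b)%N => M leM.
  rewrite /y (divn_eq M (size b)) Lambda_prod_cyclic_prefix colE -mulmxA -colE.
  apply: Hq; first by rewrite leq_divRL.
  by move=> k l; rewrite mxE; apply: nonneg_Lambda_prod.
have Aycvg k := normalized_mulmx_cvg (A := A) (i := k) mass0 near_y.
apply: (cvg_lim (@Rhausdorff R)); rewrite -(cvg_shiftn (size a)) /=.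
have Au0 : (A *m u) ord_max 0 != 0.
  by rewrite gt_eqF//; apply: pos_Lambda_prod_mulmx.
have -> : (fun M => ratr (r_convergent i a b (M + size a)) : R) =
    (fun M => (A *m y M) (rev_ord i) 0 / mass (y M))
    \* (fun M => ((A *m y M) ord_max 0 / mass (y M))^-1).
  apply/funext => M; rewrite addnC r_convergent_in /=.
  by rewrite invf_div mulrA divfK ?gt_eqF.
by apply: cvgM; [exact: Aycvg | apply: cvgV => //; exact: Aycvg].
Qed.

Unset Implicit Arguments.
Set Strict Implicit.
Set Printing Implicit Defensive.

Theorem theorem6p16 (R : realType) (m : nat) (a b : seq nat)
    (hm : (1 <= m)%N) (hk : (1 <= size b)%N)
    (ha : forall c : nat, c \in a -> (0 < c)%N)
    (hb : forall c : nat, c \in b -> (0 < c)%N) :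
  exists (K : fieldExtType rat) (iota : {rmorphism K -> R}),
    [/\ forall i : 'I_m.+1, exists z : K, iota z = r_limit R i a b,
        (\dim {:K} <= m.+1)%N
      & irreducible_poly (char_poly (Lambda_prod m b)) -> \dim {:K} = m.+1].
Proof.
pose B := Lambda_prod_in R m b.
have B0 : nonneg_mx B  by apply: nonneg_Lambda_prod.
have B2 : pos_mx (B ^+ 2).
  rewrite expr2 -mulmxE -Lambda_prod_in_cat; apply: pos_Lambda_prod.
    by move=> c; rewrite mem_cat orbb; apply: hb.
  by rewrite size_cat; lia.
have [u [lam [u0 Bu attr simple]]] := perron_frobenius B0 B2.
pose chi := char_poly (Lambda_prod m b).
have chi0 : chi != 0 by rewrite monic_neq0 // char_poly_monic.
have chi_lam : root (map_poly ratr chi) lam.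
  rewrite map_char_poly; apply/char_poly_eigencol; exists u => //.
  by apply/eqP => u_eq0; have := u0 0 0; rewrite u_eq0 mxE ltxx.
have [K [j [[x jx] jrat dimK irrK]]] := simple_extension_root chi0 chi_lam.
have size_chi : (size chi).-1 = m.+1 by rewrite size_char_poly.
rewrite size_chi in dimK irrK.
exists K, j; split=> // i.
(* An eigenvector with coordinates in [K]: its image spans the same real line as [u]. *)
pose inK (M : 'M[rat]_m.+1) : 'M[K]_m.+1 := map_mx (in_alg K) M.
have jK M : map_mx j (inK M) = map_mx ratr M :> 'M[R]_m.+1.
  by apply/matrixP=> k l; rewrite !mxE; apply: jrat.
have chi_x : root (char_poly (inK (Lambda_prod m b))) x.
  by rewrite -(fmorph_root j) map_char_poly jK jx -map_char_poly.
have [v v0 Bv] := (char_poly_eigencol _ _).1 chi_x.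
have [c vu] : exists c, map_mx j v = c *: u.
  by apply: simple; rewrite -jx -map_mxZ -Bv map_mxM jK.
have c0 : c != 0.
  apply: contra_neq v0 => c_eq0; apply: (map_mx_inj (f := j)).
  by rewrite map_mx0 vu c_eq0 scale0r.
pose w := inK (Lambda_prod m a) *m v.
exists (w (rev_ord i) 0 / w ord_max 0).
rewrite (r_limit_direction _ hk ha hb u0 attr) fmorph_div.
have jw k : j (w k 0) = c * (Lambda_prod_in R m a *m u) k 0.
  transitivity (map_mx j w k 0); first by rewrite [RHS]mxE.
  by rewrite map_mxM jK vu -scalemxAr [LHS]mxE.
by rewrite !jw -mulf_div divff// mul1r.
Qed.
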